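(* Let $H$ be a Hilbert space and let $Q\in\mathbb{B}(H)$ be any idempotent. Then $\|m(Q)-Q\|$ is the minimum operator distance from $Q$ to all projections on $H$; that is, $m(Q)$ is a projection on $H$ and $\|m(Q)-Q\|\le \|P-Q\|$ for every projection $P\in\mathbb{B}(H)$.
   Context: $H$ is a non-zero complex Hilbert space and $\mathbb{B}(H)$ is the algebra of bounded linear operators on $H$ with the operator norm; $I$ is the identity. An idempotent is $Q\in\mathbb{B}(H)$ with $Q^2=Q$; a projection is a self-adjoint idempotent. For $T\in\mathbb{B}(H)$, $|T|=(T^*T)^{1/2}$, and $T^\dag$ denotes the Moore-Penrose inverse of $T$ (when $T$ has closed range): the unique $X$ with $TXT=T$, $XTX=X$, $(TX)^*=TX$, $(XT)^*=XT$. The matched projection of an idempotent $Q$ is the projection $$m(Q)=\frac12\big(|Q^*|+Q^*\big)|Q^*|^\dag\big(|Q^*|+I\big)^{-1}\big(|Q^*|+Q\big).$$ *)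

(* Defs.v *)
From HB Require Import structures.
From mathcomp Require Import all_boot all_order all_algebra.
From mathcomp Require Import complex.
From mathcomp Require Import all_classical all_reals all_analysis.

Set Implicit Arguments.
Unset Strict Implicit.
Unset Printing Implicit Defensive.
Import Order.TTheory GRing.Theory Num.Theory.
Import numFieldNormedType.Exports.
Local Open Scope classical_set_scope.
Local Open Scope complex_scope.
Local Open Scope ring_scope.

(* The inner product is linear in its first argument and conjugate-linear in
   the second; positive definiteness is part of [{dot H for _}].  Zero spaces
   are excluded, so that bounded operators form a non-trivial ring. *)
HB.mixin Record CompleteNormedModule_isHilbert (R : realType) H
    & CompleteNormedModule R[i] H := {
  inner : {dot H for @Num.conj R[i]};
  innerE : forall x : H, inner x x = `|x| ^+ 2;
  hilbert_neq0 : exists x : H, x != 0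
}.

#[short(type="hilbertType")]
HB.structure Definition Hilbert (R : realType) :=
  {H of CompleteNormedModule R[i] H & CompleteNormedModule_isHilbert R H}.

Section BoundedOperators.
Variables (R : realType) (H : hilbertType R).

Definition bounded_linear (f : H -> H) : Prop :=
  linear f /\ exists M : R, forall x, `|f x| <= M%:C * `|x|.

Record bop := BOp {bop_fun :> H -> H; bopP : bounded_linear bop_fun}.

HB.instance Definition _ := gen_eqMixin bop.
HB.instance Definition _ := gen_choiceMixin bop.

HB.instance Definition _ (T : bop) :=
  GRing.isLinear.Build R[i] H H _ (bop_fun T) (bopP T).1.

Lemma bop_eqP (S T : bop) : bop_fun S =1 bop_fun T -> S = T.
Proof.
case: S T => [f pf] [g pg] /= /funext fg; subst g.
by congr BOp; exact: Prop_irrelevance.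
Qed.

Lemma bop_ge0_bound (T : bop) :
  exists2 M : R, 0 <= M & forall x, `|T x| <= M%:C * `|x|.
Proof.
have [_ [M TM]] := bopP T; exists `|M| => // x.
by apply: le_trans (TM x) _; rewrite ler_wpM2r// lecR ler_norm.
Qed.

Fact bop_zero_subproof : bounded_linear (fun=> 0 : H).
Proof.
split=> [a u v|]; first by rewrite scaler0 addr0.
by exists 0 => x; rewrite normr0 mul0r.
Qed.

Fact bop_opp_subproof (T : bop) : bounded_linear (fun x => - T x).
Proof.
split=> [a u v|]; first by rewrite linearP opprD scalerN.
by have [M _ TM] := bop_ge0_bound T; exists M => x; rewrite normrN.
Qed.

Fact bop_add_subproof (S T : bop) : bounded_linear (fun x => S x + T x).
Proof.
split=> [a u v|]; first by rewrite !linearP scalerDr addrACA.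
have [M _ SM] := bop_ge0_bound S; have [N _ TN] := bop_ge0_bound T.
exists (M + N) => x; rewrite rmorphD mulrDl.
by apply: le_trans (ler_normD _ _) _; exact: lerD.
Qed.

Fact bop_scale_subproof (a : R[i]) (T : bop) :
  bounded_linear (fun x => a *: T x).
Proof.
split=> [b u v|]; first by rewrite linearP scalerDr !scalerA mulrC.
have [M _ TM] := bop_ge0_bound T; exists (complex.Re `|a| * M) => x.
have aE : (complex.Re `|a|)%:C = `|a| :> R[i] by exact/RRe_real/normr_real.
have -> : (complex.Re `|a| * M)%:C = `|a| * M%:C :> R[i].
  by rewrite -[in RHS]aE -rmorphM.
by rewrite normrZ -mulrA ler_wpM2l.
Qed.

Fact bop_one_subproof : bounded_linear (@id H).
Proof. by split=> //; exists 1 => x; rewrite mul1r. Qed.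

Fact bop_mul_subproof (S T : bop) : bounded_linear (fun x => S (T x)).
Proof.
split=> [a u v|]; first by rewrite !linearP.
have [M M0 SM] := bop_ge0_bound S; have [N _ TN] := bop_ge0_bound T.
exists (M * N) => x; apply: le_trans (SM _) _.
by rewrite rmorphM -mulrA ler_wpM2l// lecR.
Qed.

Definition bop_zero := BOp bop_zero_subproof.
Definition bop_opp (T : bop) := BOp (bop_opp_subproof T).
Definition bop_add (S T : bop) := BOp (bop_add_subproof S T).
Definition bop_scale (a : R[i]) (T : bop) := BOp (bop_scale_subproof a T).
Definition bop_one := BOp bop_one_subproof.
Definition bop_mul (S T : bop) := BOp (bop_mul_subproof S T).

Fact bop_addA : associative bop_add.
Proof. by move=> S T U; apply: bop_eqP => x /=; rewrite addrA. Qed.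
Fact bop_addC : commutative bop_add.
Proof. by move=> S T; apply: bop_eqP => x /=; rewrite addrC. Qed.
Fact bop_add0 : left_id bop_zero bop_add.
Proof. by move=> T; apply: bop_eqP => x /=; rewrite add0r. Qed.
Fact bop_addN : left_inverse bop_zero bop_opp bop_add.
Proof. by move=> T; apply: bop_eqP => x /=; rewrite addNr. Qed.

HB.instance Definition _ :=
  GRing.isZmodule.Build bop bop_addA bop_addC bop_add0 bop_addN.

Fact bop_mulA : associative bop_mul.
Proof. by move=> S T U; exact: bop_eqP. Qed.
Fact bop_mul1l : left_id bop_one bop_mul.
Proof. by move=> T; exact: bop_eqP. Qed.
Fact bop_mul1r : right_id bop_one bop_mul.
Proof. by move=> T; exact: bop_eqP. Qed.
Fact bop_mulDl : left_distributive bop_mul +%R.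
Proof. by move=> S T U; exact: bop_eqP. Qed.
Fact bop_mulDr : right_distributive bop_mul +%R.
Proof. by move=> S T U; apply: bop_eqP => x /=; rewrite linearD. Qed.
Fact bop_one_neq0 : bop_one != 0.
Proof.
have [x x0] := @hilbert_neq0 R H.
by apply: contraNneq x0 => /(congr1 (fun T : bop => T x)) /= ->.
Qed.

HB.instance Definition _ := GRing.Zmodule_isNzRing.Build bop
  bop_mulA bop_mul1l bop_mul1r bop_mulDl bop_mulDr bop_one_neq0.

Fact bop_scaleA a b (T : bop) :
  bop_scale a (bop_scale b T) = bop_scale (a * b) T.
Proof. by apply: bop_eqP => x /=; rewrite scalerA. Qed.
Fact bop_scale1 : left_id 1 bop_scale.
Proof. by move=> T; apply: bop_eqP => x /=; rewrite scale1r. Qed.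
Fact bop_scaleDr : right_distributive bop_scale +%R.
Proof. by move=> a S T; apply: bop_eqP => x /=; rewrite scalerDr. Qed.
Fact bop_scaleDl T : {morph bop_scale^~ T : a b / a + b}.
Proof. by move=> a b; apply: bop_eqP => x /=; rewrite scalerDl. Qed.

HB.instance Definition _ := GRing.Zmodule_isLmodule.Build R[i] bop
  bop_scaleA bop_scale1 bop_scaleDr bop_scaleDl.

Fact bop_scaleAl (a : R[i]) (S T : bop) : a *: (S * T) = (a *: S) * T.
Proof. exact: bop_eqP. Qed.
HB.instance Definition _ :=
  GRing.Lmodule_isLalgebra.Build R[i] bop bop_scaleAl.

Fact bop_scaleAr (a : R[i]) (S T : bop) : a *: (S * T) = S * (a *: T).
Proof. by apply: bop_eqP => x /=; rewrite linearZ. Qed.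
HB.instance Definition _ :=
  GRing.Lalgebra_isAlgebra.Build R[i] bop bop_scaleAr.

Definition bop_unit : pred bop :=
  [pred T | `[< exists S : bop, S * T = 1 /\ T * S = 1 >]].
Definition bop_inv (T : bop) : bop :=
  xget T [set S : bop | S * T = 1 /\ T * S = 1].

Fact bop_mulV : {in bop_unit, left_inverse 1 bop_inv *%R}.
Proof. by move=> T /asboolP/xgetPex -/(_ T)[]. Qed.
Fact bop_divV : {in bop_unit, right_inverse 1 bop_inv *%R}.
Proof. by move=> T /asboolP/xgetPex -/(_ T)[]. Qed.
Fact bop_unitP (T S : bop) : S * T = 1 /\ T * S = 1 -> bop_unit T.
Proof. by move=> ST; apply/asboolP; exists S. Qed.
Fact bop_inv_out : {in [predC bop_unit], bop_inv =1 id}.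
Proof.
by move=> T /asboolP nT; apply: xgetPN => S ST; apply: nT; exists S.
Qed.

HB.instance Definition _ := GRing.NzRing_hasMulInverse.Build bop
  bop_mulV bop_divV bop_unitP bop_inv_out.

End BoundedOperators.

Notation "''B(' H )" := (bop H) (at level 0, format "''B(' H )") : type_scope.

Section MatchedProjection.
Variables (R : realType) (H : hilbertType R).
Implicit Types (P Q S T X : 'B(H)).

Definition opnorm T : R :=
  sup [set complex.Re `|T x| | x in [set x : H | `|x| <= 1]].

(* In this and the next choices the defining property has at most one solution;
   for [adjoint] a solution always exists by the Riesz representation theorem. *)
Definition adjoint T : 'B(H) :=
  xget 0 [set S : 'B(H) | forall x y : H, inner (T x) y = inner x (S y)].

Definition is_idempotent Q : Prop := Q * Q = Q.

Definition is_projection P : Prop := is_idempotent P /\ adjoint P = P.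

(* [0 <= z] in [R[i]] says that z is real and non-negative. *)
Definition positive_op S : Prop := forall x : H, 0 <= inner (S x) x.

(* Meaningful for positive T only. *)
Definition sqrt_op T : 'B(H) :=
  xget 0 [set S : 'B(H) | positive_op S /\ S * S = T].

Definition abs_op T : 'B(H) := sqrt_op (adjoint T * T).

(* Takes the value 0 when T has no Moore-Penrose inverse, that is, when the
   range of T is not closed. *)
Definition MPinv T : 'B(H) :=
  xget 0 [set X : 'B(H) | [/\ T * X * T = T, X * T * X = X,
                             adjoint (T * X) = T * X &
                             adjoint (X * T) = X * T]].

Definition matched_projection Q : 'B(H) :=
  let Qs := adjoint Q in
  2^-1 *: ((abs_op Qs + Qs) * MPinv (abs_op Qs) * (abs_op Qs + 1)^-1
             * (abs_op Qs + Q)).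

End MatchedProjection.

(* Main.v *)
(* Let [F = Q + Q^* - 1] and [D = Q - Q^*].  Then [F^2 = 1 + D D^* >= 1], and
   [F^2] commutes with [Q] and [Q^*], hence so does its square root [K].  The
   range projection of [Q] is [E = Q Q^* K^-2], so [|Q^*| = K E], and expanding
   the definition yields [m(Q) = (1 + U) / 2] with [U = F K^-1] self-adjoint and
   unitary.  Thus [m(Q)] is a projection.

   Let [S = 2 Q - 1], an involution.  Then [N = U S] is positive (so [U] is
   the unitary factor in the polar decomposition of [S]) and [N^-1 = U N U].
   Therefore [1/s <= N <= s] with [s = ||S||], and
   [||U - S|| = ||1 - N|| <= s - 1].  If [P] is a projection then [2 P - 1] is
   unitary, so [2 ||P - Q|| = ||(2 P - 1) - S|| >= s - 1 >= 2 ||m(Q) - Q||]. *)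

Require Import Defs.
From mathcomp Require Import all_boot all_order all_algebra.
From mathcomp Require Import all_classical all_reals all_analysis.
From mathcomp Require Import complex ring lra.

Set Implicit Arguments.
Unset Strict Implicit.
Unset Printing Implicit Defensive.
Import Order.TTheory GRing.Theory Num.Theory.
Import numFieldNormedType.Exports.
Local Open Scope classical_set_scope.
Local Open Scope complex_scope.
Local Open Scope ring_scope.

(** * The underlying real inner product *)

Section RealInner.
Variables (R : realType) (H : hilbertType R).
Implicit Types (x y z : H) (a b : R).

(** Real parts suffice, since [inner_rip] recovers the complex inner product from them, and they put
    identities and inequalities within reach of [ring], [lra] and [nra]. *)
Definition rip x y : R := complex.Re (inner x y).
Definition rnorm x : R := complex.Re `|x|.

Lemma normE x : `|x| = (rnorm x)%:C.
Proof. exact/esym/RRe_real/normr_real. Qed.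

Lemma rnorm_ge0 x : 0 <= rnorm x.
Proof. by rewrite -lecR -normE normr_ge0. Qed.

Lemma rip_xx x : rip x x = rnorm x ^+ 2.
Proof. by rewrite /rip innerE normE -rmorphXn. Qed.

Lemma ripC x y : rip x y = rip y x.
Proof.
have ReJ (c : R[i]) : complex.Re c^*%R = complex.Re c by case: c.
by rewrite /rip hermC expr0 mul1r; exact: ReJ.
Qed.

Lemma ripDl x y z : rip (x + y) z = rip x z + rip y z.
Proof. by rewrite /rip linearDl raddfD. Qed.

Lemma ripNl x z : rip (- x) z = - rip x z.
Proof. by rewrite /rip linearNl raddfN. Qed.

Lemma ripZl a x z : rip (a%:C *: x) z = a * rip x z.
Proof. by rewrite /rip linearZl_LR /=; case: (inner x z) => u v /=; lra. Qed.

Lemma ripDr x y z : rip z (x + y) = rip z x + rip z y.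
Proof. by rewrite ripC ripDl !(ripC z). Qed.

Lemma ripNr x z : rip z (- x) = - rip z x.
Proof. by rewrite ripC ripNl ripC. Qed.

Lemma ripZr a x z : rip z (a%:C *: x) = a * rip z x.
Proof. by rewrite ripC ripZl ripC. Qed.

Lemma rip_i x y : rip ('i *: x) ('i *: y) = rip x y.
Proof.
by rewrite /rip linearZl_LR linearZr_LR /=; case: (inner x y) => u v /=; lra.
Qed.

Lemma inner_rip x y : inner x y = rip x y +i* rip x ('i *: y).
Proof.
rewrite /rip linearZr_LR /=; case: (inner x y) => u v /=.
by congr (_ +i* _); lra.
Qed.

Lemma rnormD x y : rnorm (x + y) <= rnorm x + rnorm y.
Proof. by rewrite -lecR rmorphD /= -!normE ler_normD. Qed.

Lemma rnormN x : rnorm (- x) = rnorm x.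
Proof. by rewrite /rnorm normrN. Qed.

Lemma rnormZ a x : rnorm (a%:C *: x) = `|a| * rnorm x.
Proof.
rewrite /rnorm normrZ [`|x|]normE normc_def /= expr0n addr0 sqrtr_sqr /=.
by lra.
Qed.

Lemma rnorm0 : rnorm 0 = 0.
Proof. by rewrite /rnorm normr0. Qed.

Lemma rnorm_eq0 x : rnorm x <= 0 -> x = 0.
Proof.
move=> x0; apply/eqP; rewrite -normr_eq0 normE.
have /eqP -> : rnorm x == 0 by rewrite eq_le x0 rnorm_ge0.
by [].
Qed.

Definition ripE := (ripDl, ripNl, ripZl, ripDr, ripNr, ripZr).

(** Cauchy-Schwarz, by squaring the triangle inequality that the norm already satisfies. *)
Lemma rip_le x y : rip x y <= rnorm x * rnorm y.
Proof.
have := rnorm_ge0 (x + y); have := rnormD x y.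
have := rip_xx (x + y); rewrite !ripE !rip_xx (ripC y x).
by nra.
Qed.

Lemma rnorm_sqr_eq0 x : rnorm x ^+ 2 <= 0 -> x = 0.
Proof.
move=> x0; apply: rnorm_eq0.
by rewrite -(@ler_pXn2r _ 2) ?nnegrE ?rnorm_ge0// expr0n.
Qed.

Lemma rnorm_gt0 x : x != 0 -> 0 < rnorm x.
Proof.
move=> x0; rewrite lt_neqAle rnorm_ge0 andbT eq_sym.
by apply: contra_neq x0 => x0; apply: rnorm_eq0; rewrite x0.
Qed.

Lemma rip0l x : rip 0 x = 0.
Proof. by rewrite -[0](scale0r 0) (ripZl 0) mul0r. Qed.

Lemma rip_ext x y : (forall z, rip x z = rip y z) -> x = y.
Proof.
move=> xy; apply/eqP; rewrite -subr_eq0; apply/eqP/rnorm_sqr_eq0.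
by rewrite -rip_xx ripDl ripNl xy subrr.
Qed.

End RealInner.

(** * Completeness *)

Section Limits.
Variables (R : realType) (H : hilbertType R).
Implicit Types (q c e : R).

Lemma geometric_small q c e : 0 <= q -> q < 1 -> 0 < e ->
  exists k, c * q ^+ k < e.
Proof.
move=> q0 q1 e0; have /cvgrPdist_lt /(_ e e0) : geometric c q @ \oo --> (0 : R).
  by apply: cvg_geometric; rewrite ger0_norm.
move=> [k _ /(_ k (leqnn k))] /=.
rewrite sub0r normrN => /(le_lt_trans (ler_norm _)); by exists k.
Qed.

(** Replaces passages to the limit: a defect is shown to vanish by bounding it by every term of a
    geometric sequence. *)
Lemma le0_geometric q c a : 0 <= q -> q < 1 ->
  (forall k, a <= c * q ^+ k) -> a <= 0.
Proof.
move=> q0 q1 ak; rewrite leNgt; apply/negP => /(geometric_small c q0 q1)[k].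
by rewrite ltNge ak.
Qed.

(** The explicit rate is what later turns pointwise limits of operators into limits in the operator
    norm. *)
Lemma geometric_limit q c (u : nat -> H) : 0 <= q -> q < 1 ->
  (forall k, rnorm (u k.+1 - u k) <= c * q ^+ k) ->
  exists l, forall k, rnorm (l - u k) <= c / (1 - q) * q ^+ k.
Proof.
move=> q0 q1 uc.
have c0 : 0 <= c.
  by have := uc 0%N; rewrite expr0 mulr1; apply: le_trans; exact: rnorm_ge0.
have p0 : 0 < 1 - q by lra.
set d := c / (1 - q); have d0 : 0 <= d by rewrite divr_ge0// ltW.
have cE : c = d * (1 - q) by rewrite mulfVK// gt_eqF.
have tail m k : rnorm (u (m + k)%N - u k) <= d * q ^+ k.
  (* The factor [1 - q ^+ m] makes the induction go through: the bound is then the exact partial sum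
     of the geometric series. *)
  suff : rnorm (u (m + k)%N - u k) <= d * q ^+ k * (1 - q ^+ m).
    have := exprn_ge0 m q0; have := mulr_ge0 d0 (exprn_ge0 k q0).
    by move: (rnorm _) (q ^+ k) (q ^+ m) => *; nra.
  elim: m => [|m IHm]; first by rewrite add0n subrr rnorm0 expr0 subrr mulr0.
  rewrite addSn -(subrKA (u (m + k)%N)).
  apply: le_trans (rnormD _ _) _; have := uc (m + k)%N; rewrite cE exprD exprS.
  by lra.
have ucvg : cvg (u @ \oo).
  apply/cauchy_cvgP/cauchy_exP => e e0.
  have eE : e = (complex.Re e)%:C by rewrite RRe_real// gtr0_real.
  have re0 : 0 < complex.Re e by rewrite -ltcR -eE.
  have [k dk] := geometric_small d q0 q1 re0.
  exists (u k); exists k => // m /= km; rewrite -ball_normE /=.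
  rewrite eE normE ltcR; apply: le_lt_trans dk.
  by rewrite -opprB rnormN -(subnK km); exact: tail.
exists (lim (u @ \oo)) => k.
apply/ler_addgt0Pr => e e0.
have /cvgrPdist_lt /(_ e%:C) : u @ \oo --> lim (u @ \oo) by [].
rewrite ltcR => /(_ e0) [m _ /(_ (m + k)%N (leq_addr _ _))] /=.
rewrite normE ltcR => um; rewrite -(subrKA (u (m + k)%N)).
apply: le_trans (rnormD _ _) _; rewrite addrC lerD//; exact: ltW.
Qed.

End Limits.

(** * Adjoints *)

(** Cancels a factor [b] in [b ^+ 2 <= c * b * d], including the case [b = 0]. It bounds adjoints,
    with [b = |T^* x|], [a = |T T^* x|] and [d = |x|]. *)
Lemma le_of_sqr_le (R : realFieldType) (a b c d : R) :
  0 <= b -> 0 <= c -> 0 <= d -> b ^+ 2 <= a * d -> a <= c * b -> b <= c * d.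
Proof.
move=> b0 c0 d0 bad acb; rewrite leNgt; apply/negP => cdb.
have cd0 := mulr_ge0 c0 d0.
have : 0 < b * (b - c * d) by rewrite mulr_gt0 ?subr_gt0//; lra.
by nra.
Qed.

Section Adjoint.
Variables (R : realType) (H : hilbertType R).
Implicit Types (x y z h : H) (S T : 'B(H)).

(* Approximate minimisers of [|x|^2 / 2 - f x] form a Cauchy sequence, by the
   parallelogram law; their limit represents [f]. *)
Lemma riesz (f : H -> R) (M : R) : {morph f : x y / x + y} ->
  (forall a x, f (a%:C *: x) = a * f x) -> (forall x, f x <= M * rnorm x) ->
  exists z, forall x, f x = rip x z.
Proof.
move=> fD fZ fM.
pose J x := rnorm x ^+ 2 / 2 - f x.
have infJ : has_inf (range J).
  split; first by exists (J 0), 0.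
  exists (- (M ^+ 2 / 2)) => _ [x _ <-]; rewrite /J.
  by have := fM x; have := sqr_ge0 (rnorm x - M); nra.
set m := inf (range J).
have mJ x : m <= J x by apply: ge_inf; [exact: infJ.2 | exists x].
have JD x h t : J (x + t%:C *: h)
    = J x + t * rip x h + t ^+ 2 * (rnorm h ^+ 2 / 2) - t * f h.
  by rewrite /J -!rip_xx !ripE fD fZ (ripC h x); field.
have uex k : exists x, J x < m + (4^-1 ^+ k : R).
  have [|_ [x _ <-] xm] := @inf_adherent _ (range J) (4^-1 ^+ k) _ infJ.
    by rewrite exprn_gt0.
  by exists x.
have [u um] := choice uex.
have q4 k : (4^-1 : R) ^+ k = (2^-1 ^+ k) ^+ 2.
  by rewrite -exprM mulnC exprM; congr (_ ^+ k); field.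
(* The parallelogram law at the midpoint bounds the squared distance by
   [4 (4^-k + 4^-(k+1)) = 5 * 4^-k], and [5 <= 3 ^ 2]. *)
have ud k : rnorm (u k.+1 - u k) <= 3 * 2^-1 ^+ k.
  have q0 : 0 <= (2^-1 : R) ^+ k by rewrite exprn_ge0.
  rewrite -(@ler_pXn2r _ 2) ?nnegrE ?rnorm_ge0 ?mulr_ge0//.
  have /= := um k.+1; have /= := um k.
  have := mJ ((2^-1)%:C *: (u k.+1 + u k)).
  rewrite !q4 [2^-1 ^+ k.+1]exprS /J -!rip_xx fZ fD !ripE (ripC (u k) (u k.+1)).
  move: (rip _ _) (rip _ _) (rip _ _) (2^-1 ^+ k) q0 => a b c d d0.
  by nra.
have [||z zu] := geometric_limit _ _ ud; [by []|by lra|].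
(* Near-minimality of [u k] is tested along the step [2^-k h]: the accuracy [4^-k] divided by the
   step length still tends to zero. Using both [h] and [- h] gives equality. *)
have fle h : f h - rip h z <= 0.
  have := @le0_geometric _ (2^-1)
    (rnorm h ^+ 2 / 2 + 1 + 3 / (1 - 2^-1) * rnorm h) (f h - rip h z).
  apply=> [||k]; [by []|by lra|].
  have q0 : 0 < (2^-1 : R) ^+ k by rewrite exprn_gt0.
  have /= := um k; have := mJ (u k + (2^-1 ^+ k)%:C *: h).
  rewrite JD q4; have := rip_le (- h) (z - u k); have := zu k.
  rewrite !ripE rnormN (ripC h (u k)); have := rnorm_ge0 h.
  move: (2^-1 ^+ k) q0 (rip _ _) (rip _ _) (rnorm h) (rnorm (_ - _)) (f h).
  move=> d d0 uh zh n w fh n0 wd hzu mJ' Jm.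
  have := ler_wpM2l n0 wd.
  have : fh - uh <= d * (n ^+ 2 / 2 + 1) by rewrite -(ler_pM2l d0); lra.
  by lra.
exists z => h; have := fle (- h); have := fle h; have := fZ (-1) h.
by rewrite rmorphN1 scaleN1r ripNl => ->; lra.
Qed.

Lemma bounded_linearP (f : H -> H) : bounded_linear f <->
  linear f /\ exists M : R, forall x, rnorm (f x) <= M * rnorm x.
Proof.
split=> -[fL [M fM]]; split=> //; exists M => x; have := fM x;
  by rewrite !normE -rmorphM lecR.
Qed.

Lemma bop_bound T : exists2 M : R, 0 < M & forall x, rnorm (T x) <= M * rnorm x.
Proof.
have /bounded_linearP[_ [M TM]] := bopP T.
exists (`|M| + 1); first by rewrite ltr_pwDr.
move=> x; apply: le_trans (TM x) _; rewrite ler_wpM2r ?rnorm_ge0//.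
by rewrite (le_trans (ler_norm M))// lerDl.
Qed.

Lemma rip_conj (a : R[i]) x y : rip (a^*%R *: x) y = rip x (a *: y).
Proof. by rewrite /rip linearZl_LR linearZr_LR. Qed.

(** Only real parts are compared; by complex linearity of [T] and [S] this is equivalent to the
    complex adjoint relation. *)
Definition is_adjoint T S := forall x y, rip (T x) y = rip x (S y).

(** For each [y], Riesz representation of [x |-> rip (T x) y] gives [S y]; uniqueness of the
    representing vector makes [S] linear. *)
Lemma adjoint_exists T : exists S, is_adjoint T S.
Proof.
have [M M0 TM] := bop_bound T.
have /choice [S ST] : forall y, exists z, forall x, rip (T x) y = rip x z.
  move=> y; apply: (riesz (M := M * rnorm y)) => [x z|a x|x].
  - by rewrite linearD ripDl.
  - by rewrite linearZ ripZl.
  - apply: le_trans (rip_le _ _) _.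
    by rewrite mulrAC ler_wpM2r ?rnorm_ge0.
have S_bl : bounded_linear S.
  apply/bounded_linearP; split=> [a u v|].
    apply: rip_ext => x; rewrite ripDl !(ripC _ x) -ST ripDr -ST -!rip_conj.
    by rewrite -ST linearZ.
  exists M => x.
  have := ST x (S x); rewrite rip_xx => SS.
  have := rip_le (T (S x)) x; rewrite SS => SS'.
  by apply: le_of_sqr_le SS' (TM _); rewrite ?rnorm_ge0// ltW.
by exists (BOp S_bl).
Qed.

Lemma addE S T x : (S + T) x = S x + T x. Proof. by []. Qed.
Lemma oppE T x : (- T) x = - T x. Proof. by []. Qed.
Lemma mulE S T x : (S * T) x = S (T x). Proof. by []. Qed.
Lemma oneE x : (1 : 'B(H)) x = x. Proof. by []. Qed.
Lemma scaleE (a : R[i]) T x : (a *: T) x = a *: T x. Proof. by []. Qed.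
Definition bopE := (addE, oppE, mulE, oneE, scaleE).

Lemma adjointP T : is_adjoint T (adjoint T).
Proof.
have innerP S : (forall x y, inner (T x) y = inner x (S y)) <-> is_adjoint T S.
  split=> [TS x y|TS x y]; first by rewrite /rip TS.
  by rewrite !inner_rip TS TS linearZ.
apply/innerP; rewrite /adjoint; case: xgetP => [S _ //|noS].
by have [S /innerP TS] := adjoint_exists T; case: (noS S).
Qed.

Lemma adjointE T S : is_adjoint T S -> adjoint T = S.
Proof.
move=> TS; apply: bop_eqP => y; apply: rip_ext => x.
by rewrite !(ripC _ x) -TS adjointP.
Qed.

Lemma is_adjoint_sym T S : is_adjoint T S -> is_adjoint S T.
Proof. by move=> TS x y; rewrite (ripC (S x)) -TS ripC. Qed.

Lemma adjointK T : adjoint (adjoint T) = T.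
Proof. exact/adjointE/is_adjoint_sym/adjointP. Qed.

Lemma adjointD S T : adjoint (S + T) = adjoint S + adjoint T.
Proof. by apply: adjointE => x y; rewrite ripDl ripDr !adjointP. Qed.

Lemma adjointN T : adjoint (- T) = - adjoint T.
Proof. by apply: adjointE => x y; rewrite ripNl ripNr !adjointP. Qed.

Lemma adjointM S T : adjoint (S * T) = adjoint T * adjoint S.
Proof. by apply: adjointE => x y /=; rewrite !adjointP. Qed.

Lemma adjoint1 : adjoint (1 : 'B(H)) = 1.
Proof. exact: adjointE. Qed.

Lemma adjointZ (a : R) T : adjoint (a%:C *: T) = a%:C *: adjoint T.
Proof. by apply: adjointE => x y /=; rewrite ripZl ripZr adjointP. Qed.

(** [|S y|^2 = <S (S y), y>], so a self-adjoint [S] has the same kernel as its square. *)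
Lemma selfadjoint_mul_eq0 S T : adjoint S = S -> S * (S * T) = 0 -> S * T = 0.
Proof.
move=> aS SST; apply: bop_eqP => x; apply: rnorm_sqr_eq0.
by rewrite -rip_xx mulE -{2}aS -adjointP -[S (S _)]/((S * (S * T)) x) SST rip0l.
Qed.

End Adjoint.

(* Pairing with an arbitrary vector turns a linear identity between operators
   into an identity between reals. *)
Ltac bop_lin := apply: bop_eqP => ?; apply: rip_ext => ?;
  rewrite !bopE ?ripE; ring.

(** * Limits in the operator norm *)

Section BoundedBy.
Variables (R : realType) (H : hilbertType R).
Implicit Types (x y z : H) (A B S T Y Z : 'B(H)) (a b c q M : R).

(** An operator norm bound free of suprema; [opnorm] enters only at the end. *)
Definition bounded_by T c := forall x, rnorm (T x) <= c * rnorm x.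

Lemma bounded_byW T a b : a <= b -> bounded_by T a -> bounded_by T b.
Proof.
by move=> ab Ta x; apply: le_trans (Ta x) _; rewrite ler_wpM2r ?rnorm_ge0.
Qed.

Lemma bounded_byD S T a b :
  bounded_by S a -> bounded_by T b -> bounded_by (S + T) (a + b).
Proof.
by move=> Sa Tb x; rewrite mulrDl; apply: le_trans (rnormD _ _) (lerD _ _).
Qed.

Lemma bounded_byN T a : bounded_by T a -> bounded_by (- T) a.
Proof. by move=> Ta x; rewrite rnormN. Qed.

Lemma bounded_byB S T a b :
  bounded_by S a -> bounded_by T b -> bounded_by (S - T) (a + b).
Proof. by move=> Sa /bounded_byN; exact: bounded_byD. Qed.

Lemma bounded_byZ T a c : bounded_by T c -> bounded_by (a%:C *: T) (`|a| * c).
Proof. by move=> Tc x; rewrite rnormZ -mulrA ler_wpM2l. Qed.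

Lemma bounded_byM S T a b : 0 <= a ->
  bounded_by S a -> bounded_by T b -> bounded_by (S * T) (a * b).
Proof.
by move=> a0 Sa Tb x; apply: le_trans (Sa _) _; rewrite -mulrA ler_wpM2l.
Qed.

Lemma bounded_by1 : bounded_by 1 1.
Proof. by move=> x; rewrite mul1r. Qed.

Lemma bounded_byX T c k :
  0 <= c -> bounded_by T c -> bounded_by (T ^+ k) (c ^+ k).
Proof.
move=> c0 Tc; elim: k => [|k IHk]; first exact: bounded_by1.
by rewrite !exprS; exact: bounded_byM.
Qed.

Lemma bounded_by_adjoint T c :
  0 <= c -> bounded_by T c -> bounded_by (adjoint T) c.
Proof.
move=> c0 Tc x; have := rip_xx (adjoint T x).
rewrite -adjointP => E; have := rip_le (T (adjoint T x)) x; rewrite E.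
by move=> le; apply: le_of_sqr_le le (Tc _); rewrite ?rnorm_ge0.
Qed.

Lemma bounded_by_small q c T : 0 <= q -> q < 1 ->
  (forall k, bounded_by T (c * q ^+ k)) -> T = 0.
Proof.
move=> q0 q1 Tc; apply: bop_eqP => x; apply: rnorm_eq0.
apply: (@le0_geometric _ q (c * rnorm x)) => // k.
by rewrite mulrAC; exact: Tc.
Qed.

Lemma rnormZc (a : R[i]) x : rnorm (a *: x) = complex.Re `|a| * rnorm x.
Proof.
rewrite /rnorm normrZ [`|x|]normE normc_def /=.
by rewrite mul0r subr0.
Qed.

(** The limit is taken pointwise. Its linearity defect is at most a constant times [q ^+ k] for
    every [k], and its bound comes from comparison with [T 0]. *)
Lemma bop_geometric_limit q c (T : nat -> 'B(H)) : 0 <= q -> q < 1 ->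
  (forall k, bounded_by (T k.+1 - T k) (c * q ^+ k)) ->
  exists L : 'B(H), forall k, bounded_by (L - T k) (c / (1 - q) * q ^+ k).
Proof.
move=> q0 q1 Tc; set d := c / (1 - q).
have /choice [L LT] : forall x, exists l, forall k,
    rnorm (l - T k x) <= d * rnorm x * q ^+ k.
  move=> x.
  have [|l lT] := @geometric_limit _ _ q (c * rnorm x) (T ^~ x) q0 q1.
    by move=> k; rewrite mulrAC; exact: Tc.
  by exists l => k; rewrite /d [c / _ * _]mulrAC; exact: lT.
have L_bl : bounded_linear L.
  apply/bounded_linearP; split=> [a u v|].
    apply/eqP; rewrite -subr_eq0; apply/eqP/rnorm_eq0.
    apply: (@le0_geometric _ q (d * rnorm (a *: u + v)
      + complex.Re `|a| * (d * rnorm u) + d * rnorm v)) => // k.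
    have -> : L (a *: u + v) - (a *: L u + L v)
        = (L (a *: u + v) - T k (a *: u + v))
          + a *: (- (L u - T k u)) + - (L v - T k v).
      rewrite (linearP (T k)) opprB scalerDr scalerN.
      by apply: rip_ext => z; rewrite !ripE; ring.
    apply: le_trans (rnormD _ _) _; rewrite mulrDl lerD//; last first.
      by rewrite rnormN.
    apply: le_trans (rnormD _ _) _; rewrite mulrDl lerD//.
    rewrite rnormZc rnormN -mulrA ler_wpM2l//.
    by rewrite -lecR RRe_real ?normr_real// normr_ge0.
  have [M M0 TM] := bop_bound (T 0%N).
  exists (d + M) => x; rewrite -(subrK (T 0%N x) (L x)) mulrDl.
  apply: le_trans (rnormD _ _) (lerD _ (TM x)).
  by have := LT x 0%N; rewrite expr0 mulr1.
exists (BOp L_bl) => k x; rewrite mulrAC; exact: LT.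
Qed.

Section LimitProperties.
Variables (q d : R) (T : nat -> 'B(H)) (L : 'B(H)).
Hypotheses (q0 : 0 <= q) (q1 : q < 1) (d0 : 0 <= d).
Hypothesis LT : forall k, bounded_by (L - T k) (d * q ^+ k).

Let dq0 k : 0 <= d * q ^+ k. Proof. by rewrite mulr_ge0 ?exprn_ge0. Qed.

(** The commutator of [L] with [B] equals that of [L - T k], which is small. The next lemmas use the
    same comparison. *)
Lemma comm_limit B : (forall k, GRing.comm (T k) B) -> GRing.comm L B.
Proof.
move=> TB; have [M M0 BM] := bop_bound B.
apply/eqP; rewrite -subr_eq0; apply/eqP.
apply: (@bounded_by_small q (d * M + M * d)) => // k.
have -> : L * B - B * L = (L - T k) * B - B * (L - T k).
  by rewrite mulrBl mulrBr TB; bop_lin.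
have -> : (d * M + M * d) * q ^+ k = d * q ^+ k * M + M * (d * q ^+ k) by ring.
by apply: bounded_byB; apply: bounded_byM => //; exact: ltW.
Qed.

Lemma adjoint_limit : (forall k, adjoint (T k) = T k) -> adjoint L = L.
Proof.
move=> TT; apply/eqP; rewrite -subr_eq0; apply/eqP.
apply: (@bounded_by_small q (d + d)) => // k.
have -> : adjoint L - L = adjoint (L - T k) - (L - T k).
  by rewrite adjointD adjointN TT; bop_lin.
by rewrite mulrDl; apply: bounded_byB => //; exact: bounded_by_adjoint.
Qed.

Lemma bounded_by_limit c : (forall k, bounded_by (T k) c) -> bounded_by L c.
Proof.
move=> Tc x; rewrite -subr_le0.
apply: (@le0_geometric _ q (d * rnorm x)) => // k.
have := rnormD ((L - T k) x) (T k x); rewrite subrK.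
by have := LT k x; have := Tc k x; lra.
Qed.

End LimitProperties.

(** Neumann series: the partial sums telescope against [1 - Y], and the limit commutes with [Y], so
    the inverse is two-sided. *)
Lemma neumann Y q : 0 <= q -> q < 1 -> bounded_by Y q ->
  exists Z, Z * (1 - Y) = 1 /\ (1 - Y) * Z = 1.
Proof.
move=> q0 q1 Yq; pose T k := \sum_(i < k) Y ^+ i.
have [|Z ZT] := @bop_geometric_limit q 1 T q0 q1.
  move=> k; rewrite /T big_ord_recr /= addrAC subrr add0r mul1r.
  exact: bounded_byX.
have d0 : 0 <= 1 / (1 - q) by rewrite divr_ge0// subr_ge0 ltW.
have YZ : GRing.comm Z Y.
  apply: (comm_limit q0 q1 d0 ZT) => k.
  by apply/commr_sym/commr_sum => i _; exact: commrX.
have E : (1 - Y) * Z = 1.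
  apply/eqP; rewrite -subr_eq0; apply/eqP.
  apply: (@bounded_by_small q ((1 + q) * (1 / (1 - q)) + 1)) => // k.
  have -> : (1 - Y) * Z - 1 = (1 - Y) * (Z - T k) - Y ^+ k.
    rewrite mulrBr; have -> : (1 - Y) * T k = 1 - Y ^+ k.
      by rewrite -opprB mulNr -subrX1 opprB.
    by bop_lin.
  rewrite [_ * q ^+ k]mulrDl [1 * q ^+ k]mul1r -mulrA.
  apply: bounded_byB; last exact: bounded_byX.
  apply: bounded_byM => //; first by rewrite addr_ge0.
  by apply: bounded_byB => //; exact: bounded_by1.
by exists Z; split=> //; move: E; rewrite mulrBl mul1r -YZ mulrBr mulr1.
Qed.

End BoundedBy.

(** * Square roots and positive operators *)

Section SquareRoot.
Variables (R : realType) (H : hilbertType R).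
Implicit Types (x y : H) (A B C G : 'B(H)) (c M : R).

(* Positivity of [A] at [x - M^-1 A x]. *)
Lemma positive_norm_sqr A M : adjoint A = A -> 0 < M -> bounded_by A M ->
  (forall x, 0 <= rip (A x) x) ->
  forall x, rnorm (A x) ^+ 2 <= M * rip (A x) x.
Proof.
move=> AA M0 AM A0 x; have := A0 (x - (M^-1)%:C *: A x).
have sym y z : rip (A y) z = rip y (A z) by rewrite adjointP AA.
rewrite linearB linearZ /= !ripE (sym (A x) x) rip_xx.
have w_le : rip (A (A x)) (A x) <= M * rnorm (A x) ^+ 2.
  apply: le_trans (rip_le _ _) _.
  by rewrite expr2 mulrA ler_wpM2r ?rnorm_ge0.
have t0 : 0 < M^-1 by rewrite invr_gt0.
have MV : M * M^-1 = 1 by rewrite divff// gt_eqF.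
move: (M^-1) t0 MV (rip _ _) (rip _ _) (rnorm _ ^+ 2) w_le => t t0 Mt a w n wn.
have : t * (t * w) <= t * n by rewrite ler_pM2l// -(ler_pM2l M0) mulrA Mt mul1r.
by move=> tw pos; rewrite -(mul1r n) -Mt -mulrA ler_pM2l//; lra.
Qed.

(** [(1 - L)^2 = 1 - Y] is the fixed-point equation [L = (Y + L^2) / 2]. Iteration from 0 stays in
    the ball of radius [q], since [(q + q^2) / 2 <= q], and contracts there with ratio [q]. The
    iterates are polynomials in [Y], so self-adjointness and commutation pass to the limit. *)
Lemma sqrt_one_sub Y q : 0 <= q -> q < 1 -> bounded_by Y q -> adjoint Y = Y ->
  exists L, [/\ bounded_by L q, adjoint L = L, (1 - L) * (1 - L) = 1 - Y
    & forall B, GRing.comm Y B -> GRing.comm L B].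
Proof.
move=> q0 q1 Yq YY.
have [W [W0 WS]] : exists W : nat -> 'B(H),
    W 0%N = 0 /\ forall k, W k.+1 = (2^-1)%:C *: (Y + W k * W k).
  by exists (fun k => iter k (fun w : 'B(H) => (2^-1)%:C *: (Y + w * w)) 0).
have h2 : `|2^-1 : R| = 2^-1 by rewrite ger0_norm.
have Wq k : bounded_by (W k) q.
  elim: k => [|k IHk]; first by move=> x; rewrite W0 rnorm0 mulr_ge0 ?rnorm_ge0.
  rewrite WS.
  apply: bounded_byW (bounded_byZ _ (bounded_byD Yq (bounded_byM q0 IHk IHk))).
  by rewrite h2; nra.
have Wd k : bounded_by (W k.+1 - W k) (1 * q ^+ k).
  elim: k => [|k IHk].
    by rewrite W0 subr0 expr0 mulr1; apply: bounded_byW (Wq 1%N); exact: ltW.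
  have -> : W k.+2 - W k.+1
      = (2^-1)%:C *: (W k.+1 * (W k.+1 - W k) + (W k.+1 - W k) * W k).
    by rewrite (WS k.+1) [X in _ - X = _]WS mulrBr mulrBl; bop_lin.
  have qk0 : 0 <= 1 * q ^+ k by rewrite mulr_ge0 ?exprn_ge0.
  have := bounded_byD (bounded_byM q0 (Wq k.+1) IHk)
                      (bounded_byM qk0 IHk (Wq k)).
  move=> /(bounded_byZ 2^-1); rewrite h2; apply: bounded_byW.
  by rewrite exprS; lra.
have [L LW] := bop_geometric_limit q0 q1 Wd.
set d := 1 / (1 - q) in LW; have d0 : 0 <= d by rewrite divr_ge0// subr_ge0 ltW.
(* The defect of the limit equation is [2 (L - W k.+1) - (L^2 - W k ^2)], which is of order
   [q ^+ k]. *)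
have LL : L + L = Y + L * L.
  apply/eqP; rewrite -subr_eq0; apply/eqP.
  apply: (@bounded_by_small _ _ q (2 * d + 2 * q * d)) => // k.
  have -> : L + L - (Y + L * L)
     = (2 : R)%:C *: (L - W k.+1) - (L * (L - W k) + (L - W k) * W k).
    rewrite WS scalerBr scalerA.
    have -> : (2 : R)%:C * (2^-1)%:C = 1 by rewrite -rmorphM divff.
    by rewrite scale1r mulrBr mulrBl; bop_lin.
  have -> : (2 * d + 2 * q * d) * q ^+ k
    = (2 * (d * q ^+ k)) + (q * (d * q ^+ k) + d * q ^+ k * q) by ring.
  have dq0 : 0 <= d * q ^+ k by rewrite mulr_ge0 ?exprn_ge0.
  apply: bounded_byB.
    have := bounded_byZ 2 (LW k.+1); rewrite ger0_norm//; apply: bounded_byW.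
    by rewrite exprS; nra.
  apply: bounded_byD; apply: bounded_byM => //.
  exact: bounded_by_limit LW _ Wq.
exists L; split.
- exact: bounded_by_limit LW _ Wq.
- apply: (adjoint_limit q0 q1 d0 LW); elim=> [|k IHk].
    by rewrite W0 -(subrr 1) adjointD adjointN adjoint1.
  by rewrite WS adjointZ adjointD adjointM IHk YY.
- rewrite mulrBl !mulrBr !mul1r mulr1.
  have -> : L * L = L + L - Y by rewrite LL; bop_lin.
  by bop_lin.
- move=> B YB; apply: (comm_limit q0 q1 d0 LW) => k; elim: k => [|k IHk].
    by rewrite W0; exact/commr_sym/commr0.
  rewrite WS /GRing.comm -scalerAl -scalerAr; congr (_ *: _).
  by rewrite mulrDl mulrDr YB -mulrA IHk mulrA IHk -mulrA.
Qed.

(** Write [A = M (1 - Y)] with [||Y|| <= q < 1] and take [C = sqrt M (1 - L)], where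
    [(1 - L)^2 = 1 - Y]. As [||L|| <= q], the Neumann series inverts [C], and
    [C >= sqrt M (1 - q)]. *)
Lemma sqrt_exists A c : adjoint A = A -> 0 < c ->
  (forall x, c * rnorm x ^+ 2 <= rip (A x) x) ->
  exists C G, [/\ adjoint C = C, C * C = A,
    forall B, GRing.comm A B -> GRing.comm C B, C * G = 1 /\ G * C = 1
    & exists2 e, 0 < e & forall x, e * rnorm x ^+ 2 <= rip (C x) x].
Proof.
move=> AA c0 Ac; have [M0 M00 AM0] := bop_bound A.
pose M := M0 + c; have Mc : c < M by rewrite /M; lra.
have M_gt0 : 0 < M by lra.
have AM : bounded_by A M by apply: bounded_byW AM0; rewrite /M; lra.
have MV : M * M^-1 = 1 by rewrite divff// gt_eqF.
have A0 x : 0 <= rip (A x) x.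
  by apply: le_trans (Ac x); rewrite mulr_ge0 ?sqr_ge0// ltW.
have cM : 0 < c / M < 1 by rewrite divr_gt0//= ltr_pdivrMr ?mul1r.
(* From [|A x|^2 <= M <A x, x>] one gets [|Y x|^2 <= (1 - c / M) |x|^2]; the half in [q] takes the
   root, by [1 - t <= (1 - t / 2)^2]. *)
pose Y := 1 - (M^-1)%:C *: A; pose q := 1 - c / M / 2.
have q0 : 0 <= q by rewrite /q; lra.
have q1 : q < 1 by rewrite /q; lra.
have Yq : bounded_by Y q.
  move=> x; rewrite -(@ler_pXn2r _ 2) ?nnegrE ?mulr_ge0 ?rnorm_ge0//.
  rewrite -rip_xx !bopE !ripE !rip_xx (ripC x).
  have := positive_norm_sqr AA M_gt0 AM A0 x; have := Ac x.
  rewrite exprMn /q; move: (M^-1) MV => t Mt.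
  have t0 : 0 < t by nra.
  move: (rip _ _) (rnorm x ^+ 2) (rnorm (A x) ^+ 2) (sqr_ge0 (rnorm x)).
  move=> a b n b0 ca na.
  have : t * (t * n) <= t * a.
    by rewrite ler_pM2l// -(ler_pM2l M_gt0) mulrA Mt mul1r.
  have := ler_wpM2l (ltW t0) ca; have := mulr_ge0 (sqr_ge0 (c * t)) b0.
  by nra.
have YY : adjoint Y = Y by rewrite adjointD adjointN adjointZ AA adjoint1.
have [L [Lq LL L2 Lcomm]] := sqrt_one_sub q0 q1 Yq YY.
pose r := Num.sqrt M; have r0 : 0 < r by rewrite sqrtr_gt0.
have rV : r * r^-1 = 1 by rewrite divff// gt_eqF.
have [Z [ZL LZ]] := neumann q0 q1 Lq.
exists (r%:C *: (1 - L)), ((r^-1)%:C *: Z); split.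
- by rewrite adjointZ adjointD adjointN LL adjoint1.
- rewrite -scalerAl -scalerAr scalerA -rmorphM -expr2 sqr_sqrtr ?ltW// L2.
  by rewrite /Y opprB addrC subrK scalerA -rmorphM MV scale1r.
- move=> B AB; rewrite /GRing.comm -scalerAl -scalerAr; congr (_ *: _).
  rewrite mulrBl mulrBr Lcomm ?mul1r ?mulr1//.
  by rewrite /GRing.comm /Y mulrBl mulrBr -scalerAl -scalerAr AB mul1r mulr1.
- rewrite -!scalerAl -!scalerAr ZL LZ !scalerA -!rmorphM [r^-1 * r]mulrC rV.
  by rewrite !scale1r.
exists (r * (1 - q)); first by rewrite mulr_gt0// subr_gt0.
move=> x; rewrite !bopE !ripE -mulrA ler_pM2l// rip_xx.
have := rip_le (L x) x; have := ler_wpM2r (rnorm_ge0 x) (Lq x).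
by lra.
Qed.

End SquareRoot.

(** * Inverses, commuting products and norm bounds for positive operators *)

Section PositiveOperators.
Variables (R : realType) (H : hilbertType R).
Implicit Types (x y : H) (A B C G S T X Y : 'B(H)).

Lemma commr_inverse A B G :
  A * G = 1 -> G * A = 1 -> GRing.comm A B -> GRing.comm G B.
Proof.
move=> AG GA AB; rewrite /GRing.comm -[G * B]mulr1 -AG mulrA -[G * B * A]mulrA.
by rewrite -AB mulrA GA mul1r.
Qed.

Lemma adjoint_inverse A G :
  adjoint A = A -> A * G = 1 -> G * A = 1 -> adjoint G = G.
Proof.
move=> AA AG GA; have := congr1 (@adjoint _ _) AG.
rewrite adjointM AA adjoint1 => /(congr1 ( *%R^~ G)).
by rewrite -mulrA AG mulr1 mul1r.
Qed.

Lemma inv_bopE A G : A * G = 1 -> G * A = 1 -> A^-1 = G.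
Proof.
move=> AG GA; have uA : A \is a GRing.unit by apply/unitrP; exists G.
by apply: (mulrI uA); rewrite AG divrr.
Qed.

Lemma positive_inverse A c : adjoint A = A -> 0 < c ->
  (forall x, c * rnorm x ^+ 2 <= rip (A x) x) ->
  exists G, A * G = 1 /\ G * A = 1.
Proof.
move=> AA c0 Ac; have [C [G [_ <- _ [CG GC] _]]] := sqrt_exists AA c0 Ac.
exists (G * G); split; first by rewrite mulrA -[C * C * G]mulrA CG mulr1.
by rewrite mulrA -[G * G * C]mulrA GC mulr1.
Qed.

(* The square root of [B + eps] commutes with [A], so that [A * (B + eps)] is
   positive for every [eps > 0]. *)
Lemma positive_comm_mul A B : adjoint A = A -> adjoint B = B ->
  GRing.comm A B -> (forall x, 0 <= rip (A x) x) ->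
  (forall x, 0 <= rip (B x) x) -> forall x, 0 <= rip ((A * B) x) x.
Proof.
move=> AA BB AB A0 B0 x; apply/ler_addgt0Pr => e e0.
set a := rip (A x) x; have a0 : 0 <= a by exact: A0.
have d0 : 0 < e / (a + 1) by rewrite divr_gt0// ltr_wpDl.
(* Adding [d] to [B] changes the form at [x] by [d * a], which this choice keeps below [e]. *)
set d := e / (a + 1) in d0.
have de : d * (a + 1) = e by rewrite mulfVK// gt_eqF// ltr_wpDl.
pose D := B + d%:C *: 1.
have DD : adjoint D = D by rewrite adjointD adjointZ BB adjoint1.
have Dd y : d * rnorm y ^+ 2 <= rip (D y) y.
  by rewrite !bopE ripDl ripZl rip_xx lerDr.
have [C [_ [CC C2 Ccomm _ _]]] := sqrt_exists DD d0 Dd.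
have CA : GRing.comm C A.
  apply: Ccomm; rewrite /GRing.comm /D mulrDl mulrDr AB -scalerAl -scalerAr.
  by rewrite mul1r mulr1.
have : 0 <= rip ((A * D) x) x.
  by rewrite -C2 mulrA -CA -mulrA !mulE adjointP CC.
rewrite /D mulrDr -scalerAr mulr1 !bopE ripDl ripZl -/a; nra.
Qed.

Lemma rip_ir x y : rip x ('i *: y) = - rip ('i *: x) y.
Proof.
have ii : 'i * 'i = -1 :> R[i].
  by apply/eqP; rewrite eq_complex /=; apply/andP; split; apply/eqP; ring.
by rewrite -rip_i scalerA ii scaleN1r ripNr.
Qed.

(** Complex positivity makes [<S x, x>] real for all [x], and polarisation turns this into
    self-adjointness. *)
Lemma positive_opP S : positive_op S <->
  adjoint S = S /\ forall x, 0 <= rip (S x) x.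
Proof.
split=> [S0|[SS S0] x]; last first.
  rewrite inner_rip lecE /= S0 andbT; apply/eqP.
  have : rip (S x) ('i *: x) = - rip (S x) ('i *: x).
    by rewrite {1}rip_ir -linearZ adjointP SS ripC.
  by lra.
have im x : rip (S x) ('i *: x) = 0.
  by have := S0 x; rewrite inner_rip lecE /= => /andP[/eqP].
split=> [|x]; last by have := S0 x; rewrite inner_rip lecE /= => /andP[].
(* Polarisation: the diagonal terms vanish, and the cross terms are the two sides of the adjoint
   relation. *)
apply: adjointE => x y; have := im (x + 'i *: y).
rewrite linearD linearZ /= scalerDr !ripE !rip_i !im rip_ir rip_i (ripC x).
by lra.
Qed.

Lemma sqrt_opE A B : positive_op B -> B * B = A ->
  (forall S, positive_op S -> S * S = A -> S = B) -> sqrt_op A = B.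
Proof.
by move=> B0 BA uB; apply: xget_unique => // S [S0 SA]; exact: uB.
Qed.

(** Uniqueness settles the choice: for another solution [Y], self-adjointness forces [T * Y = T * X]
    and [Y * T = X * T], hence [Y = X]. *)
Lemma MPinvE T X : T * X * T = T -> X * T * X = X ->
  adjoint (T * X) = T * X -> adjoint (X * T) = X * T -> MPinv T = X.
Proof.
move=> TXT XTX aTX aXT; apply: xget_unique => // Y [TYT YTY aTY aYT].
have TXY : T * Y = T * X.
  by rewrite -aTY -[in LHS]TXT -mulrA adjointM aTX aTY mulrA TYT.
have XYT : Y * T = X * T.
  rewrite -[in LHS]TXT -[T * X * T]mulrA mulrA -aYT -aXT -adjointM.
  by rewrite -mulrA [T * (Y * T)]mulrA TYT.
by rewrite -YTY XYT -mulrA TXY mulrA XTX.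
Qed.

(* With [N = U * S] one has [N^-1 = S * U], so that [s^-1 <= N <= s] and
   [(s - N) * (s - 2 + N) >= 0], that is, [(1 - N) ^+ 2 <= (s - 1) ^+ 2]. *)
Lemma involution_polar_bound U S s : U * U = 1 -> adjoint U = U -> S * S = 1 ->
  adjoint (U * S) = U * S -> (forall x, 0 <= rip ((U * S) x) x) ->
  1 <= s -> bounded_by S s -> bounded_by (U - S) (s - 1).
Proof.
move=> UU aU SS aN N0 s1 Ss; have s0 : 0 < s by lra.
have Un x : rnorm (U x) = rnorm x.
  apply/eqP; rewrite -(@eqrXn2 _ 2) ?rnorm_ge0// -!rip_xx adjointP aU.
  by rewrite -mulE UU.
set N := U * S in aN N0; pose N' := S * U.
have N'N : N' * N = 1 by rewrite /N' mulrA -[S * U * U]mulrA UU mulr1.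
have aN' : adjoint N' = N'.
  have : N' = U * N * U by rewrite /N mulrA UU mul1r.
  by move=> ->; rewrite adjointM aU adjointM aU aN mulrA.
have N's : bounded_by N' s by move=> x; rewrite -[X in _ * X]Un; exact: Ss.
have N'0 x : 0 <= rip (N' x) x.
  have -> : N' = U * N * U by rewrite /N mulrA UU mul1r.
  by rewrite !mulE adjointP aU; exact: N0.
have Ns x : rnorm (N x) <= s * rnorm x by rewrite mulE Un.
(* [|N' y|^2 <= s <N' y, y>] at [y = N x] says that [N >= 1/s]. *)
have N_ge x : rnorm x ^+ 2 <= s * rip (N x) x.
  have := positive_norm_sqr aN' s0 N's N'0 (N x).
  by rewrite -!mulE N'N ripC.
have N_le x : rip (N x) x <= s * rnorm x ^+ 2.
  apply: le_trans (rip_le _ _) _.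
  by rewrite expr2 mulrA ler_wpM2r ?rnorm_ge0.
pose A := N - (2 - s)%:C *: 1; pose B := s%:C *: 1 - N.
(* [N >= 1/s >= 2 - s], the last inequality being [(s - 1)^2 >= 0]. *)
have A0 x : 0 <= rip (A x) x.
  rewrite !bopE !ripE rip_xx; have := N_ge x; have := N0 x.
  move: (rip _ _) (rnorm x ^+ 2) (sqr_ge0 (rnorm x)) => a b b0 a0 ba.
  case: (lerP s 2) => s2; last by nra.
  have := ler_wpM2l (_ : 0 <= 2 - s) ba; rewrite subr_ge0 => /(_ s2).
  have := mulr_ge0 (sqr_ge0 (s - 1)) a0.
  by nra.
have B0 x : 0 <= rip (B x) x.
  by rewrite !bopE !ripE rip_xx; have := N_le x; lra.
have AB : GRing.comm A B.
  rewrite /A /B; apply: commrB; apply: commr_sym; apply: commrB => //.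
  - by apply: commr_sym; rewrite /GRing.comm -scalerAl -scalerAr mulr1 mul1r.
  - by rewrite /GRing.comm -!scalerAl -!scalerAr !mulr1 !scalerA mulrC.
  - by rewrite /GRing.comm -scalerAl -scalerAr mulr1 mul1r.
have aA : adjoint A = A by rewrite adjointD adjointN adjointZ adjoint1 aN.
have aB : adjoint B = B by rewrite adjointD adjointN adjointZ adjoint1 aN.
move=> x; have := positive_comm_mul aA aB AB A0 B0 x.
rewrite /A /B mulrBl !mulrBr -!scalerAl -!scalerAr !mulr1 !mul1r !bopE !ripE.
have NN : rip (N (N x)) x = rnorm (N x) ^+ 2 by rewrite adjointP aN rip_xx.
rewrite -[U (S x)]/(N x) -[U (S (N x))]/(N (N x)) NN rip_xx => AB0.
rewrite -(@ler_pXn2r _ 2) ?nnegrE ?mulr_ge0 ?rnorm_ge0 ?subr_ge0//.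
(* [U] is isometric, so [|(U - S) x| = |(1 - N) x|]. *)
rewrite -[rnorm ((U - S) x)]Un -mulE mulrBr UU -/N exprMn -rip_xx.
rewrite addE oppE oneE !ripE !rip_xx (ripC x).
by lra.
Qed.

End PositiveOperators.

(** * The matched projection *)

Section OperatorNorm.
Variables (R : realType) (H : hilbertType R).
Implicit Types (x : H) (T P : 'B(H)) (c : R).

Let opnorm_set T := [set complex.Re `|T x| | x in [set x : H | `|x| <= 1]].

Lemma opnorm_le T c : bounded_by T c -> 0 <= c -> opnorm T <= c.
Proof.
move=> Tc c0; apply: ge_sup.
  by exists (rnorm (T 0)), 0; rewrite //= normr0 ler01.
move=> _ [x x1 <-]; apply: le_trans (Tc x) _.
by rewrite ler_piMr// -lecR -normE.
Qed.

Lemma bounded_by_opnorm T : bounded_by T (opnorm T).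
Proof.
have [M M0 TM] := bop_bound T.
have ub : has_ubound (opnorm_set T).
  exists M => _ [x x1 <-]; apply: le_trans (TM x) _.
  by rewrite ler_piMr ?(ltW M0)// -lecR -normE.
move=> x; have [->|x0] := eqVneq x 0; first by rewrite linear0 rnorm0 mulr0.
have nx0 := rnorm_gt0 x0.
rewrite -ler_pdivrMr//; apply: ub_le_sup => //.
exists ((rnorm x)^-1%:C *: x).
  by rewrite /= normE rnormZ ger0_norm ?invr_ge0 ?(ltW nx0)// mulVf ?gt_eqF//.
by rewrite linearZ /= -/(rnorm _) rnormZ ger0_norm ?invr_ge0 ?(ltW nx0)// mulrC.
Qed.

Lemma opnorm_ge0 T : 0 <= opnorm T.
Proof.
have [x x0] := @hilbert_neq0 R H.
have := bounded_by_opnorm T x; have := rnorm_ge0 (T x).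
have nx0 := rnorm_gt0 x0.
by move=> /le_trans le /le; rewrite pmulr_lge0.
Qed.

(** [2 P - 1] is isometric because [<P x, P x> = <P x, x>]. *)
Lemma projection_reflection P x : is_projection P ->
  rnorm (P x + P x - x) = rnorm x.
Proof.
move=> [PP aP]; apply/eqP; rewrite -(@eqrXn2 _ 2) ?rnorm_ge0// -!rip_xx !ripE.
have -> : rip (P x) (P x) = rip (P x) x.
  by rewrite adjointP aP -mulE PP ripC adjointP aP.
by rewrite (ripC x); apply/eqP; ring.
Qed.

End OperatorNorm.

(** * Closed form of the matched projection *)

Section MatchedProjection.
Variables (R : realType) (H : hilbertType R) (q : 'B(H)).
Hypothesis qq : q * q = q.
Implicit Types (x : H).

Local Notation p := (adjoint q).
Local Notation F := (q + p - 1).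

Let pp : p * p = p. Proof. by rewrite -adjointM qq. Qed.
Let Fq : F * q = p * q.
Proof. by rewrite mulrBl mulrDl qq mul1r addrAC subrr add0r. Qed.
Let Fp : F * p = q * p.
Proof. by rewrite mulrBl mulrDl pp mul1r addrK. Qed.
Let qF : q * F = q * p.
Proof. by rewrite mulrBr mulrDr qq mulr1 addrAC subrr add0r. Qed.
Let pF : p * F = p * q.
Proof. by rewrite mulrBr mulrDr pp mulr1 addrK. Qed.
Let FF : F * F = q * p + p * q - F.
Proof. by rewrite {1}mulrBl mulrDl qF pF mul1r. Qed.
Let aF : adjoint F = F.
Proof. by rewrite !adjointD adjointN adjoint1 adjointK [p + q]addrC. Qed.
(** [F] interchanges [q] and [p]: [F q = p q = p F] and [F p = q p = q F]. Hence its square commutes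
    with both. *)
Let FFq : GRing.comm (F * F) q.
Proof.
by rewrite /GRing.comm -mulrA Fq mulrA Fp [RHS]mulrA qF -[RHS]mulrA pF mulrA.
Qed.
Let FFp : GRing.comm (F * F) p.
Proof.
by rewrite /GRing.comm -mulrA Fp mulrA Fq [RHS]mulrA pF -[RHS]mulrA qF mulrA.
Qed.

Let FF_ge1 x : 1 * rnorm x ^+ 2 <= rip ((F * F) x) x.
Proof.
have -> : F * F = 1 - (q - p) * (q - p).
  by rewrite FF mulrBl !mulrBr qq pp; bop_lin.
have a : adjoint (q - p) = - (q - p).
  by rewrite adjointD adjointN adjointK opprB addrC.
rewrite mul1r addE oppE oneE mulE ripDl ripNl rip_xx lerDl adjointP a oppE.
by rewrite ripNr opprK rip_xx sqr_ge0.
Qed.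

(** Evaluates the definition once and for all: [K] is the positive square root of [F * F] and [G]
    its inverse. The factors [|p|], its Moore-Penrose inverse and the inverse of [|p| + 1] are
    computed from [K] and the range projection [E] of [q]. *)
Lemma matched_projection_reflection : exists K G : 'B(H),
  [/\ K * G = 1 /\ G * K = 1, GRing.comm K q /\ GRing.comm K p, K * K = F * F,
      adjoint K = K & forall x, 0 <= rip (K x) x] /\
  matched_projection q = (2^-1)%:C *: (1 + F * G).
Proof.
have aFF : adjoint (F * F) = F * F by rewrite adjointM aF.
have [K [G [aK KK Kcomm [KG GK] [e e0 Ke]]]] := sqrt_exists aFF ltr01 FF_ge1.
have K0 x : 0 <= rip (K x) x.
  by apply: le_trans (Ke x); rewrite mulr_ge0 ?sqr_ge0 ?ltW.
have Kq := Kcomm _ FFq; have Kp := Kcomm _ FFp.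
exists K, G; split; first by split.
have Gcomm B : GRing.comm K B -> GRing.comm G B by exact: commr_inverse.
have Gq := Gcomm _ Kq; have Gp := Gcomm _ Kp.
have aG := adjoint_inverse aK KG GK.
have KF : GRing.comm K F.
  by apply: commrB; [exact: commrD | exact: commr1].
have GF := Gcomm _ KF.
have KqpC : GRing.comm K (q * p) by exact: commrM.
have GqpC : GRing.comm G (q * p) by exact: commrM.
have GKC : GRing.comm G K by rewrite /GRing.comm KG GK.
have KKGG : K * K * (G * G) = 1 by rewrite mulrA -[K * K * G]mulrA KG mulr1.
have aqp : adjoint (q * p) = q * p by rewrite adjointM adjointK.
have qpq : q * p * q = q * (K * K).
  by rewrite KK [RHS]mulrA qF -[RHS]mulrA pF mulrA.
(* [E] is the orthogonal projection onto the range of [q]: it begins with [q], satisfies [E q = q],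
   and is self-adjoint. *)
pose E := q * p * (G * G).
have aE : adjoint E = E.
  rewrite /E adjointM (adjointM G) aG aqp.
  by apply/commr_sym/commrM; exact: commr_sym.
have KE : GRing.comm K E.
  by apply: commrM => //; apply: commrM; exact: commr_sym.
have GE := Gcomm _ KE.
have KKE : K * K * E = q * p.
  have KKqp : GRing.comm (K * K) (q * p).
    by apply: commr_sym; apply: commrM; exact: commr_sym.
  by rewrite /E mulrA KKqp -mulrA KKGG mulr1.
have Eq : E * q = q.
  have GGq : GRing.comm (G * G) q.
    by apply: commr_sym; apply: commrM; exact: commr_sym.
  by rewrite /E -mulrA GGq mulrA qpq -mulrA KKGG mulr1.
have pE : p * E = p by rewrite -{1}aE -adjointM Eq.
have EE : E * E = E by rewrite {2}/E !mulrA Eq -mulrA.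
(* From here on [E] enters only through the identities just proved. *)
clearbody E.
have LL : K * E * (K * E) = q * p.
  by rewrite mulrA -[K * E * K]mulrA -KE mulrA -[K * K * E * E]mulrA EE KKE.
have aL : adjoint (K * E) = K * E by rewrite adjointM aE aK KE.
(* The strict lower bound of [K] survives on the range of [E]; the uniqueness of the square root
   rests on it. *)
have L_ge x : e * rnorm (E x) ^+ 2 <= rip ((K * E) x) x.
  have -> : K * E = E * K * E by rewrite -KE -mulrA EE.
  by rewrite !mulE adjointP aE; exact: Ke.
have L0 : positive_op (K * E).
  by apply/positive_opP; split=> // x; apply: le_trans (L_ge x);
    rewrite mulr_ge0 ?sqr_ge0 ?ltW.
have absE : abs_op p = K * E.
  rewrite /abs_op adjointK; apply: sqrt_opE => // S /positive_opP[aS S0] SS.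
  (* [S] vanishes on the complement of [E], because [S^2 (1 - E) = q p (1 - E) = 0]. *)
  have SE : S * E = S.
    apply/eqP; rewrite -subr_eq0 -{2}[S]mulr1 -mulrBr; apply/eqP.
    apply: selfadjoint_mul_eq0 aS _.
    by rewrite mulrA SS -mulrA mulrBr pE mulr1 subrr mulr0.
  have ES : E * S = S by rewrite -{1}aS -aE -adjointM SE aS.
  (* [K^2 S = K^2 E S = S^3], and symmetrically [S K^2 = S^3]; so [S] commutes with [F^2], hence
     with its root [K]. *)
  have KS : GRing.comm K S.
    have EKK : E * (K * K) = q * p by rewrite mulrA -KE -mulrA -KE mulrA.
    apply: Kcomm; rewrite /GRing.comm -KK -[in LHS]ES mulrA KKE.
    by rewrite -[in RHS]SE -[RHS]mulrA EKK -SS mulrA.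
  set D := S - K * E.
  have SLD : (S + K * E) * D = 0.
    rewrite /D mulrBr !mulrDl SS LL [S * (K * E)]mulrA -KS.
    rewrite -mulrA SE -[K * E * S]mulrA ES.
    by rewrite [K * S + _]addrC subrr.
  have ED : E * D = D.
    by rewrite /D mulrBr ES mulrA -KE -mulrA EE.
  (* In [<S D x, D x> + <K E D x, D x> = 0] both terms are non-negative, and the second is at least
     [e |D x|^2] as [E D = D]. *)
  apply/eqP; rewrite -subr_eq0 -/D; apply/eqP/bop_eqP => x.
  apply: rnorm_sqr_eq0.
  have := congr1 (fun T : 'B(H) => rip (T x) (D x)) SLD.
  rewrite mulE addE ripDl.
  have := S0 (D x); have := L_ge (D x).
  rewrite -[E (D x)]/((E * D) x) ED -[(0 : 'B(H)) x]/(0 : H) rip0l.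
  by move=> eD SD0 SLD0; rewrite -(ler_pM2l e0) mulr0; lra.
have LGE : K * E * (G * E) = E.
  by rewrite KE -mulrA [K * (G * E)]mulrA KG mul1r EE.
have GEL : G * E * (K * E) = E.
  by rewrite GE -mulrA [G * (K * E)]mulrA GK mul1r EE.
have MPE : MPinv (K * E) = G * E.
  apply: MPinvE; rewrite ?LGE ?GEL ?aE//.
    by rewrite mulrA -KE -mulrA EE.
  by rewrite mulrA -GE -mulrA EE.
have [V [KV VK]] : exists V, (K + 1) * V = 1 /\ V * (K + 1) = 1.
  apply: (@positive_inverse _ _ (K + 1) 1); rewrite ?ltr01//.
    by rewrite adjointD adjoint1 aK.
  by move=> x; rewrite addE oneE ripDl rip_xx mul1r lerDr.
have K1E : GRing.comm (K + 1) E.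
  by apply/commr_sym/commrD; [exact: commr_sym | exact: commr1].
have VE := commr_inverse KV VK K1E.
(* [K E + 1] acts as [K + 1] on the range of [E] and as the identity on its complement. *)
have invE : (K * E + 1)^-1 = V * E + (1 - E).
  have LE : K * E + 1 = (K + 1) * E + (1 - E).
    by rewrite mulrDl mul1r addrA addrAC addrK.
  have E1 : E * (1 - E) = 0 by rewrite mulrBr mulr1 EE subrr.
  have E2 : (1 - E) * E = 0 by rewrite mulrBl mul1r EE subrr.
  have E3 : (1 - E) * (1 - E) = 1 - E by rewrite mulrBl E1 subr0 mul1r.
  have aux A B : A * B = 1 -> GRing.comm B E ->
      (A * E + (1 - E)) * (B * E + (1 - E)) = 1.
    move=> AB BE; move: (1 - E) E1 E2 E3 (subrK E 1) => E' E1 E2 E3 E4.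
    rewrite mulrDl !mulrDr E3 -!mulrA E1 mulr0 addr0 BE.
    rewrite (mulrA E E) EE (mulrA E') E2 mul0r add0r -BE mulrA AB mul1r.
    by rewrite addrC.
  by rewrite LE; apply: inv_bopE; apply: aux.
rewrite /matched_projection absE MPE invE.
have lft : K * E + p = (K + p) * E by rewrite mulrDl pE.
have rgt : K * E + q = E * (K + q) by rewrite mulrDr Eq KE.
have mid : E * (G * E) * (V * E + (1 - E)) * E = E * (G * V).
  have -> : E * (G * E) = G * E by rewrite GE mulrA EE.
  rewrite -!mulrA mulrDl mulrBl mul1r EE subrr addr0 -mulrA EE.
  by rewrite VE !mulrA -GE -[G * E * E]mulrA EE.
have mE : (K * E + p) * (G * E) * (V * E + (1 - E)) * (K * E + q) = 1 + F * G.
  rewrite {1}lft rgt.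
  have -> : (K + p) * E * (G * E) * (V * E + (1 - E)) * (E * (K + q))
     = (K + p) * (E * (G * E) * (V * E + (1 - E)) * E) * (K + q).
    by rewrite !mulrA.
  have Vp : GRing.comm V p.
    by apply: (commr_inverse KV VK); apply/commr_sym/commrD;
      [exact: commr_sym | exact: commr1].
  have VK' : GRing.comm V K.
    by apply: (commr_inverse KV VK); apply/commr_sym/commrD;
      [exact: commr_refl | exact: commr1].
  have GVC : GRing.comm (G * V) ((K + p) * E).
    apply: commrM; first apply: commrD;
      by apply/commr_sym/commrM; apply: commr_sym.
  rewrite mid (mulrA _ E) -GVC -mulrA.
  (* The left side is [(q p + p q) + K (q + p)]. Here [q p + p q = K^2 + F] and [q + p = F + 1]; the
     factor [K + 1] then cancels [V]. *)
  have -> : (K + p) * E * (K + q) = (K + 1) * (K + F).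
    have -> : (K + p) * E * (K + q) = q * p + K * q + (K * p + p * q).
      rewrite -lft mulrDl !mulrDr -(mulrA K E q) Eq -(mulrA K E K) -KE mulrA.
      by rewrite KKE Kp.
    by rewrite mulrDl mulrDr KK FF mul1r mulrBr mulrDr mulr1; bop_lin.
  by rewrite -mulrA (mulrA V) VK mul1r mulrDr GK GF.
by rewrite mE fmorphV rmorph_nat.
Qed.

End MatchedProjection.

(** * Projection property and minimality of the distance *)

Theorem theorem2p3 (R : realType) (H : hilbertType R) (Q : 'B(H)) :
  is_idempotent Q ->
  is_projection (matched_projection Q) /\
  forall P : 'B(H), is_projection P ->
    opnorm (matched_projection Q - Q) <= opnorm (P - Q).
Proof.
move=> QQ; have [K [G [[[KG GK] [Kq Kp] KK aK K0] ->]]] :=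
  matched_projection_reflection QQ.
set p := adjoint Q in Kp KK *; set F := Q + p - 1 in KK *.
have aG := adjoint_inverse aK KG GK.
have Gq := commr_inverse KG GK Kq; have Gp := commr_inverse KG GK Kp.
have aF : adjoint F = F.
  by rewrite /F !adjointD adjointN adjoint1 adjointK [p + Q]addrC.
have GF : GRing.comm G F by apply: commrB; [exact: commrD | exact: commr1].
set U := F * G.
have UU : U * U = 1.
  rewrite /U -GF mulrA -[G * F * G]mulrA -GF !mulrA -[G * G * F * F]mulrA -KK.
  by rewrite -[G * G * _]mulrA [G * (K * K)]mulrA GK mul1r GK.
have aU : adjoint U = U by rewrite /U adjointM aG aF GF.
split.
  split; last by rewrite adjointZ adjointD adjoint1 aU.
  rewrite /is_idempotent -scalerAl -scalerAr mulrDl !mulrDr !mulr1 mul1r UU.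
  congr (_ *: _); apply: bop_eqP => x; apply: rip_ext => y.
  by rewrite !bopE !ripE; field.
move=> P PP; set d := opnorm (P - Q); have d0 : 0 <= d by exact: opnorm_ge0.
pose S := Q + Q - 1.
have SS : S * S = 1.
  by rewrite /S mulrBl !mulrBr !mulrDl !mulrDr QQ; bop_lin.
(* [S = (2 P - 1) - 2 (P - Q)] with [2 P - 1] isometric. The bound [s = 1 + 2 d] serves in place of
   [||S||], so that [s - 1] is exactly [2 d]. *)
have Ss : bounded_by S (1 + 2 * d).
  move=> x; have -> : S x = (P x + P x - x) - (2 : R)%:C *: (P - Q) x.
    by apply: rip_ext => y; rewrite !bopE !ripE; ring.
  apply: le_trans (rnormD _ _) _; rewrite projection_reflection// rnormN rnormZ.
  have := bounded_by_opnorm (P - Q) x; rewrite -/d ger0_norm//.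
  by move: (rnorm x) (rnorm _) => a b; lra.
(* The right side is a sum of two products [adjoint T * T], for [T = Q] and [T = 1 - Q], hence
   positive. *)
have FS : F * S = p * Q + (1 - p) * (1 - Q).
  by rewrite /F /S mulrBl mulrDl !mulrBr !mulrDr mulrBl QQ; bop_lin.
have aFS : adjoint (F * S) = F * S.
  by rewrite FS !(adjointD, adjointM, adjointN, adjoint1) adjointK.
have FS0 x : 0 <= rip ((F * S) x) x.
  rewrite FS addE ripDl !mulE -/p.
  have -> : 1 - p = adjoint (1 - Q) by rewrite adjointD adjointN adjoint1.
  rewrite !(is_adjoint_sym (adjointP _)) !rip_xx.
  by rewrite addr_ge0 ?sqr_ge0.
have GS : GRing.comm G S by apply: commrB; [exact: commrD | exact: commr1].
have GFS : GRing.comm G (F * S) by exact: commrM.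
have US : U * S = G * (F * S) by rewrite /U -GF mulrA.
have G0 x : 0 <= rip (G x) x.
  by have := K0 (G x); rewrite -mulE KG ripC.
have aUS : adjoint (U * S) = U * S by rewrite US adjointM aFS aG GFS.
(* [U S = G (F S)] is a product of commuting positive operators. *)
have US0 x : 0 <= rip ((U * S) x) x by rewrite US; exact: positive_comm_mul.
have s1 : 1 <= 1 + 2 * d by lra.
have := involution_polar_bound UU aU SS aUS US0 s1 Ss.
have -> : 1 + 2 * d - 1 = 2 * d by ring.
move=> /(bounded_byZ 2^-1).
have -> : (2^-1)%:C *: (U - S) = (2^-1)%:C *: (1 + U) - Q.
  by apply: bop_eqP => x; apply: rip_ext => y; rewrite !bopE !ripE; field.
have -> : `|2^-1 : R| * (2 * d) = d by rewrite ger0_norm// mulKf.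
by move/opnorm_le; exact.
Qed.
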